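(* Let $d\ge 1$, $\beta>0$, $\lambda>0$, and let $G:\mathbb{R}^d\to\mathbb{R}$ be measurable and such that the density $\rho$ below is normalizable. Let $$\rho(x)=\frac1Z\exp\bigl(-\beta(\lambda\|x\|_1+G(x))\bigr),\qquad x\in\mathbb{R}^d,$$ and, on $\mathcal X=(0,\infty)^d\times\mathbb{R}^d$, let $$\pi(u,v)=\frac1{Z_\pi}\prod_{i=1}^d u_i\,\exp\Bigl(-\beta\bigl(\tfrac12\lambda(\|u\|^2+\|v\|^2)+G(u\odot v)\bigr)\Bigr),$$ where $Z,Z_\pi$ are the normalization constants making $\rho,\pi$ probability densities. If $(u,v)\sim\pi$, then $x=u\odot v\sim\rho$. In particular, for any smooth $\phi:\mathbb{R}^d\to\mathbb{R}$ (for which the integrals are defined), $$\int_{\mathcal X}\phi(u\odot v)\,\pi(u,v)\,du\,dv=\int_{\mathbb{R}^d}\phi(x)\,\rho(x)\,dx.$$ Furthermore, the normalization constants satisfy $$\frac1Z=\frac1{Z_\pi}\left(\sqrt{\frac{\pi}{2\beta\lambda}}\right)^d,$$ where in this last formula $\pi$ denotes the number $3.14159\ldots$.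
   Context: $u\odot v$ is the entrywise (Hadamard) product, $\|x\|_1=\sum_i|x_i|$, and $\|\cdot\|$ is the Euclidean norm. *)

(* Defs.v *)
From HB Require Import structures.
From mathcomp Require Import all_boot all_order all_algebra.
From mathcomp Require Import all_classical all_reals all_analysis.
From mathcomp Require Import measurable_realfun.

Set Implicit Arguments.
Unset Strict Implicit.
Unset Printing Implicit Defensive.

Import Order.TTheory GRing.Theory Num.Theory.
Import numFieldNormedType.Exports.

Local Open Scope classical_set_scope.
Local Open Scope ring_scope.

(* The sigma-algebra on R^n is the product of the Borel sigma-algebras of the
   coordinates, as the library does for n.-tuple; it is the Borel sigma-algebra
   of R^n. *)
Definition measure_rV_display : measure_display. Proof. exact. Qed.

Section measurable_rV.
Variables (R : realType) (n : nat).

Definition coors (i : 'I_n) (x : 'rV[R]_n) : R := x ord0 i.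

Let rV_set0 : g_sigma_preimage coors set0.
Proof. exact: sigma_algebra0. Qed.

Let rV_setC A : g_sigma_preimage coors A -> g_sigma_preimage coors (~` A).
Proof. exact: sigma_algebraC. Qed.

Let rV_bigcup (F : (set 'rV[R]_n)^nat) :
  (forall i, g_sigma_preimage coors (F i)) ->
  g_sigma_preimage coors (\bigcup_i (F i)).
Proof. exact: sigma_algebra_bigcup. Qed.

HB.instance Definition _ := @isMeasurable.Build measure_rV_display
  'rV[R]_n (g_sigma_preimage coors) rV_set0 rV_setC rV_bigcup.

Lemma measurable_coors (i : 'I_n) : measurable_fun [set: 'rV[R]_n] (coors i).
Proof.
move=> _ Y mY; rewrite setTI; apply: sub_sigma_algebra => /=.
rewrite -bigcup_seq/=; exists i => /=; first by rewrite mem_index_enum.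
by exists Y => //; rewrite setTI.
Qed.

Lemma measurable_fun_rVP d (T : measurableType d) (f : T -> 'rV[R]_n) :
  (forall i, measurable_fun [set: T] (coors i \o f)) ->
  measurable_fun [set: T] f.
Proof.
move=> mf; have sub : g_sigma_preimage (fun i => coors i \o f) `<=` measurable.
  apply: smallest_sub; first exact: sigma_algebra_measurable.
  move=> A; rewrite -bigcup_seq/= => -[i _ [B mB <-]].
  exact: mf.
move=> _ A mA; apply: sub; rewrite g_sigma_preimage_comp.
by exists A.
Qed.

End measurable_rV.

Section lebesgue_rV.
Variable R : realType.

Definition rV_cons n (p : R * 'rV[R]_n) : 'rV[R]_n.+1 :=
  \row_i (if unlift ord0 i is Some j then p.2 ord0 j else p.1).

Definition rV_uncons n (x : 'rV[R]_n.+1) : R * 'rV[R]_n :=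
  (x ord0 ord0, \row_j x ord0 (lift ord0 j)).

Lemma rV_consK n : cancel (@rV_cons n) (@rV_uncons n).
Proof.
case=> a x; congr pair; first by rewrite mxE unlift_none.
by apply/rowP => j; rewrite !mxE liftK.
Qed.

Lemma measurable_rV_cons n :
  measurable_fun [set: measurableTypeR R * 'rV[R]_n] (@rV_cons n).
Proof.
apply: measurable_fun_rVP => i; rewrite /comp /coors /rV_cons.
under eq_fun do rewrite mxE.
case: (unlift ord0 i) => [j|]; last exact: measurable_fst.
by apply: (measurableT_comp (@measurable_coors R n j)); exact: measurable_snd.
Qed.

Lemma measurable_rV_uncons n :
  measurable_fun [set: 'rV[R]_n.+1]
    (@rV_uncons n : _ -> measurableTypeR R * 'rV[R]_n).
Proof.
apply/measurable_fun_pairP; split; first exact: (@measurable_coors R n.+1 ord0).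
apply: measurable_fun_rVP => j; rewrite /comp /coors /=.
under eq_fun do rewrite mxE.
exact: (@measurable_coors R n.+1 (lift ord0 j)).
Qed.

Section lebesgue_step.
Variables (n : nat) (mu : {sigma_finite_measure set 'rV[R]_n -> \bar R}).

Definition lebesgue_step : set 'rV[R]_n.+1 -> \bar R :=
  pushforward (@lebesgue_measure R \x mu)%E (@rV_cons n).

Let rV_cons_preimage (A : set 'rV[R]_n.+1) : measurable A ->
  measurable ((@rV_cons n : measurableTypeR R * 'rV[R]_n -> _) @^-1` A).
Proof.
by move=> mA; rewrite -[X in measurable X]setTI; exact: measurable_rV_cons.
Qed.

Let lebesgue_step0 : lebesgue_step set0 = 0%E.
Proof. by rewrite /lebesgue_step /pushforward preimage_set0 measure0. Qed.

Let lebesgue_step_ge0 A : (0 <= lebesgue_step A)%E.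
Proof.
by rewrite /lebesgue_step /pushforward; exact: measure_ge0.
Qed.

Let lebesgue_step_sigma_additive : semi_sigma_additive lebesgue_step.
Proof.
move=> F mF tF mUF; rewrite /lebesgue_step /pushforward preimage_bigcup.
apply: measure_semi_sigma_additive.
- by move=> k; exact: rV_cons_preimage.
- apply/trivIsetP => i j _ _ ij; rewrite -preimage_setI.
  by move/trivIsetP : tF => /(_ _ _ _ _ ij) ->//; rewrite preimage_set0.
- by rewrite -preimage_bigcup; exact: rV_cons_preimage.
Qed.

HB.instance Definition _ := isMeasure.Build _ _ _ lebesgue_step
  lebesgue_step0 lebesgue_step_ge0 lebesgue_step_sigma_additive.

Let lebesgue_step_sigma_finite : sigma_finite setT lebesgue_step.
Proof.
have /sigma_finiteP[F [TF ndF Foo]] := sigma_finiteT (@lebesgue_measure R).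
have /sigma_finiteP[G [TG ndG Goo]] := sigma_finiteT mu.
exists (fun k => @rV_uncons n @^-1` (F k `*` G k)).
  rewrite -preimage_bigcup -[LHS](preimage_setT (@rV_uncons n)).
  congr (_ @^-1` _); rewrite -setXTT TF TG predeqE => -[x y]; split.
    move=> [/= [i _ Fix] [k _ Gky]]; exists (maxn i k) => //; split.
    - by move: x Fix; exact/subsetPset/ndF/leq_maxl.
    - by move: y Gky; exact/subsetPset/ndG/leq_maxr.
  by move=> [i _ []/= ? ?]; split; exists i.
move=> k; have [mF Fk] := Foo k; have [mG Gk] := Goo k; split.
  rewrite -[X in measurable X]setTI; apply: measurable_rV_uncons => //.
  exact: measurableX.
rewrite /lebesgue_step /pushforward -comp_preimage
  (_ : _ \o _ = id) ?preimage_id; last by apply/funext => p; exact: rV_consK.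
by rewrite product_measure1E// lte_mul_pinfty// ge0_fin_numE.
Qed.

HB.instance Definition _ := Measure_isSigmaFinite.Build _ _ _ lebesgue_step
  lebesgue_step_sigma_finite.

End lebesgue_step.

Fixpoint lebesgue_rV n : {sigma_finite_measure set 'rV[R]_n -> \bar R} :=
  match n with
  | 0 => dirac (0 : 'rV[R]_0)
  | m.+1 => lebesgue_step (lebesgue_rV m)
  end.

Lemma lebesgue_rV_box n (A : 'I_n -> set R) :
  (forall i, measurable (A i)) ->
  lebesgue_rV n [set x | forall i, A i (x ord0 i)] =
  (\prod_i @lebesgue_measure R (A i))%E.
Proof.
elim: n A => [|n IH] A mA.
  by rewrite big_ord0 /= diracE mem_set // => -[].
rewrite big_ord_recl -IH => [|i]; last exact: mA.
have mB : measurable [set x : 'rV[R]_n | forall i, A (lift ord0 i) (x ord0 i)].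
  rewrite (_ : mkset _ = \bigcap_(i in [set: 'I_n])
    (@coors R n i @^-1` A (lift ord0 i))); last first.
    by apply/seteqP; split => [x Ax i _|x Ax i]; [exact: Ax|exact: (Ax i I)].
  apply: fin_bigcap_measurable => // i _.
  by rewrite -[X in measurable X]setTI; exact: (@measurable_coors R n i).
rewrite -(@product_measure1E _ _ (measurableTypeR R)) //; last exact: mA.
rewrite /= /lebesgue_step /pushforward.
congr (product_measure1 _ _ _).
apply/seteqP; split => [[a x] /= Aax|[a x] /= [Aa Ax] i].
  split=> [|i]; first by have := Aax ord0; rewrite mxE unlift_none.
  by have := Aax (lift ord0 i); rewrite mxE liftK.
by rewrite mxE; case: unliftP => [j|] ->.
Qed.

End lebesgue_rV.

Section functions_rV.
Variables (R : realType) (d : nat).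
Implicit Types (u v x : 'rV[R]_d) (f : 'rV[R]_d -> R).

Definition hadamard u v : 'rV[R]_d := map2_mx *%R u v.

Definition l1norm x : R := \sum_i `|x ord0 i|.

(* The library norm on 'rV[R]_d is the sup norm. *)
Definition l2norm x : R := Num.sqrt (\sum_i x ord0 i ^+ 2).

Definition iter_partial (s : seq 'I_d) f : 'rV[R]_d -> R :=
  foldr (fun i g => 'D_(delta_mx ord0 i) g) f s.

Definition smooth f : Prop := forall s : seq 'I_d,
  continuous (iter_partial s f) /\
  forall (i : 'I_d) x, derivable (iter_partial s f) x (delta_mx ord0 i).

End functions_rV.

Section densities.
Variables (R : realType) (d d' : measure_display).
Variables (S : measurableType d) (T : measurableType d').

(* The random element X has a law carried by D, with density f with respect to
   the restriction of mu to D. *)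
Definition has_density (P : probability S R) (X : S -> T)
    (mu : set T -> \bar R) (D : set T) (f : T -> R) : Prop :=
  measurable_fun [set: S] X /\
  forall A, measurable A ->
    pushforward P X A = (\int[mu]_(x in D `&` A) (f x)%:E)%E.

(* The library's integral is total; the Lebesgue integral of f over D is
   defined, possibly with an infinite value, when the positive and negative
   parts of f do not both have infinite integral. *)
Definition integral_defined (mu : set T -> \bar R) (D : set T) (f : T -> \bar R)
    : Prop :=
  measurable_fun D f /\
  ((\int[mu]_(x in D) (f^\+ x) < +oo)%E \/ (\int[mu]_(x in D) (f^\- x) < +oo)%E).

End densities.

Section model.
Variables (R : realType) (d : nat) (beta lambda : R) (G : 'rV[R]_d -> R).

Definition rho_weight (x : 'rV[R]_d) : R :=
  expR (- beta * (lambda * l1norm x + G x)).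

Definition rho_Z : \bar R := (\int[lebesgue_rV R d]_x (rho_weight x)%:E)%E.

Definition rho (x : 'rV[R]_d) : R := (fine rho_Z)^-1 * rho_weight x.

Definition lebesgue_rV2 :
    {measure set ('rV[R]_d * 'rV[R]_d) -> \bar R} :=
  (lebesgue_rV R d \x lebesgue_rV R d)%E.

Definition calX : set ('rV[R]_d * 'rV[R]_d) :=
  [set p : 'rV[R]_d * 'rV[R]_d | forall i, 0 < p.1 ord0 i].

Definition pi_weight (p : 'rV[R]_d * 'rV[R]_d) : R :=
  (\prod_i p.1 ord0 i) *
  expR (- beta * (2^-1 * lambda * (l2norm p.1 ^+ 2 + l2norm p.2 ^+ 2)
                  + G (hadamard p.1 p.2))).

Definition pi_Z : \bar R := (\int[lebesgue_rV2]_(p in calX) (pi_weight p)%:E)%E.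

Definition pi_density (p : 'rV[R]_d * 'rV[R]_d) : R :=
  (fine pi_Z)^-1 * pi_weight p.

End model.

Arguments lebesgue_rV2 R d : clear implicits.
Arguments calX R d : clear implicits.

(* Main.v *)
(* The substitution x = u v at fixed u > 0 cancels the Jacobian factor u, and
   u^2 + v^2 = (u - |v|)^2 + 2 |u v|.  So the weight of pi is the weight of rho
   at u v times the factors u_i g(u_i - |v_i|), with g an even Gaussian, and in
   one coordinate the claim is that the integral of g(u - b / u) over u > 0 does
   not depend on b >= 0 (Cauchy-Schloemilch): with b = m^2, the inversion
   u -> m^2 / u folds (0, m] onto [m, +oo), the two halves add up to
   g(u - b / u) (1 + b / u^2), and 1 + b / u^2 is the derivative of u - b / u.
   Tonelli gives the d-dimensional identity by induction on d. *)

Require Import Defs.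
From HB Require Import structures.
From mathcomp Require Import all_boot all_order all_algebra.
From mathcomp Require Import all_classical all_reals all_analysis.
From mathcomp Require Import measurable_realfun ring lra.

Import Order.TTheory GRing.Theory Num.Theory.
Import numFieldNormedType.Exports.

Local Open Scope classical_set_scope.
Local Open Scope ring_scope.

(** * Substitution and the Cauchy-Schloemilch identity *)

Section substitution.
Context {R : realType}.
Implicit Types x y : R.
Variables F f : R -> R.
Hypothesis dF : forall x : R, 0 < x -> is_derive x 1 F (f x).
Hypothesis cf : forall x : R, 0 < x -> {for x, continuous f}.

Let cF x : 0 < x -> {for x, continuous F}.
Proof.
by move=> x0; apply/differentiable_continuous/derivable1_diffP; case: (dF x x0).
Qed.

Let derive1F x : 0 < x -> F^`()%classic x = f x.
Proof. by move=> x0; rewrite derive1E; case: (dF x x0). Qed.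

Let near_derive1F x : 0 < x -> \forall y \near x, F^`()%classic y = f y.
Proof.
by move=> x0; near=> y; apply: derive1F; near: y; exact: lt_nbhsr.
Unshelve. all: by end_near. Qed.

Let cvg_derive1F x : 0 < x -> F^`()%classic y @[y --> x] --> f x.
Proof.
move=> x0; apply: cvg_trans (cf x x0); apply: near_eq_cvg.
by apply: filterS (near_derive1F x x0) => y ->.
Qed.

Let continuous_derive1F x : 0 < x -> {for x, continuous F^`()%classic}.
Proof.
by move=> x0; rewrite /continuous_at /prop_for derive1F//; exact: cvg_derive1F.
Qed.

(** As [0 < a], the half-line from [a] stays inside the open set where [F] is differentiable, so the
    one-sided conditions at [a] follow from two-sided ones. The finite limit [l] of the derivative
    is the condition at infinity. *)
Lemma ge0_substitutiony_increasing (l a : R) (g : R -> R) : 0 < a ->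
  (forall x, 0 < x -> 0 < f x) ->
  f x @[x --> +oo] --> l -> F x @[x --> +oo] --> +oo ->
  continuous g -> (forall x, 0 <= g x) ->
  (\int[lebesgue_measure]_(x in `[F a, +oo[) (g x)%:E =
   \int[lebesgue_measure]_(x in `[a, +oo[) (g (F x) * f x)%:E)%E.
Proof.
move=> a0 f0 fl Fy cg g0.
rewrite (@increasing_ge0_integration_by_substitutiony _ F g a)//.
- apply: eq_integral => x; rewrite inE/= in_itv/= andbT => ax.
  by rewrite !fctE derive1F// (lt_le_trans a0).
- move=> x y; rewrite !in_itv/= !andbT => ax ay xy.
  apply: (@gtr0_derive1_lt_cc _ F x y); rewrite ?bound_itvE ?(ltW xy)//.
  + by move=> z; rewrite in_itv/= => /andP[xz _]; case: (dF z); [lra|].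
  + move=> z; rewrite in_itv/= => /andP[xz _].
    by rewrite derive1F ?f0//; lra.
  + apply: continuous_in_subspaceT => z.
    by rewrite inE/= in_itv/= => /andP[xz _]; apply: cF; lra.
- by move=> x; rewrite in_itv/= andbT => ax; apply: continuous_derive1F; lra.
- apply/cvg_ex; exists (f a); apply: cvg_at_right_filter; exact: cvg_derive1F.
- apply/cvg_ex; exists l; apply: cvg_trans fl; apply: near_eq_cvg.
  by near=> x; rewrite derive1F//; near: x; exact: nbhs_pinfty_gt.
- split=> [x|].
    by rewrite in_itv/= andbT => ax; case: (dF x); [lra|].
  by apply: cvg_at_right_filter; exact: cF.
- exact: continuous_subspaceT.
Unshelve. all: by end_near. Qed.

Lemma substitution_decreasing (a b : R) (g : R -> R) : 0 < a -> a <= b ->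
  (forall x, 0 < x -> f x < 0) ->
  {within `[F b, F a], continuous g} ->
  (\int[lebesgue_measure]_(x in `[F b, F a]) (g x)%:E =
   \int[lebesgue_measure]_(x in `[a, b]) (g (F x) * - f x)%:E)%E.
Proof.
move=> a0 ab f0 cg.
rewrite (@integration_by_substitution_decreasing _ F g a b)//.
- apply: eq_integral => x; rewrite inE/= in_itv/= => /andP[ax _] .
  by rewrite !fctE derive1F// (lt_le_trans a0).
- move=> x y; rewrite !in_itv/= => /andP[ax _] /andP[ay _] xy.
  apply: (@ltr0_derive1_lt_cc _ F y x); rewrite ?bound_itvE ?(ltW xy)//.
  + by move=> z; rewrite in_itv/= => /andP[xz _]; case: (dF z); [lra|].
  + move=> z; rewrite in_itv/= => /andP[xz _].
    by rewrite derive1F ?f0//; lra.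
  + apply: continuous_in_subspaceT => z.
    by rewrite inE/= in_itv/= => /andP[xz _]; apply: cF; lra.
- by move=> x; rewrite in_itv/= => /andP[ax _]; apply: continuous_derive1F; lra.
- apply/cvg_ex; exists (f a); apply: cvg_at_right_filter; exact: cvg_derive1F.
- apply/cvg_ex; exists (f b); apply: cvg_at_left_filter; apply: cvg_derive1F; lra.
- split=> [x||].
  + by rewrite in_itv/= => /andP[ax _]; case: (dF x); [lra|].
  + by apply: cvg_at_right_filter; exact: cF.
  + by apply: cvg_at_left_filter; apply: cF; lra.
Qed.

End substitution.

(** * Inversion on the half-line and the Cauchy-Schloemilch identity *)

Section cauchy_schloemilch.
Context {R : realType}.
Implicit Types (b m x : R) (g h : R -> R).
Local Notation mu := lebesgue_measure.

Let is_derive_divr b x : 0 < x ->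
  is_derive x 1 (fun u : R => b / u) (- (b / x ^+ 2)).
Proof.
move=> x0; have x1 : x != 0 by rewrite gt_eqF.
have := is_deriveZ b (is_deriveV x1 (is_derive_id x (1 : R))).
rewrite scaleNr /= scalerN => d.
have : is_derive x (1:R) (fun u : R => b / u) (- (b *: (x ^- 2 *: 1))) by [].
by rewrite /GRing.scale/= mulr1.
Qed.

Let continuous_divr_sqr b x : 0 < x ->
  {for x, continuous (fun u : R => b / u ^+ 2)}.
Proof.
move=> x0; apply: cvgM; first exact: cvg_cst.
by apply: cvgV; [rewrite gt_eqF ?exprn_gt0|exact: exprn_continuous].
Qed.

Let continuous_divr b x : 0 < x -> {for x, continuous (fun u : R => b / u)}.
Proof.
move=> x0; apply: cvgM; first exact: cvg_cst.
by apply: cvgV; [rewrite gt_eqF|exact: cvg_id].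
Qed.

Let continuous_pos_measurable (i : interval R) h : [set` i] `<=` `]0, +oo[ ->
  (forall x, 0 < x -> {for x, continuous h}) -> measurable_fun [set` i] h.
Proof.
move=> i0 ch; apply: measurable_funS i0 _ => //.
apply: open_continuous_measurable_fun; first exact: interval_open.
by move=> x; rewrite inE/= in_itv/= andbT; exact: ch.
Qed.

(** The inversion is singular at 0, so the substitution is made on compact intervals and the limit
    taken by monotone convergence. *)
Lemma ge0_integral_inversion m h : 0 < m ->
  (forall x, 0 < x -> {for x, continuous h}) -> (forall x, 0 < x -> 0 <= h x) ->
  (\int[mu]_(x in `]0%R, m]) (h x)%:E =
   \int[mu]_(x in `[m, +oo[) (h (m ^+ 2 / x) * (m ^+ 2 / x ^+ 2))%:E)%E.
Proof.
move=> m0 ch h0.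
(* [F n] is the image of [G n] under the inversion, which fixes [m]; the [F n] exhaust the left
   domain and the [G n] the right one. *)
pose F (n : nat) := `[m ^+ 2 / (m + n%:R), m].
pose G (n : nat) := `[m, m + n%:R].
have mn0 n : 0 < m + n%:R :> R by rewrite ltr_wpDr.
have m20 : 0 < m ^+ 2 by rewrite exprn_gt0.
have FG n : (\int[mu]_(x in [set` F n]) (h x)%:E =
   \int[mu]_(x in [set` G n]) (h (m ^+ 2 / x) * (m ^+ 2 / x ^+ 2))%:E)%E.
  have mE : m ^+ 2 / m = m by rewrite expr2 mulfK ?gt_eqF.
  have := @substitution_decreasing R (fun x => m ^+ 2 / x)
    (fun x => - (m ^+ 2 / x ^+ 2)) (is_derive_divr _) _ m (m + n%:R) h m0.
  rewrite /= mE => ->.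
  - by under eq_integral do rewrite opprK.
  - by move=> x x0; apply: cvgN; exact: continuous_divr_sqr.
  - by rewrite lerDl.
  - by move=> x x0; rewrite oppr_lt0 divr_gt0// exprn_gt0.
  - apply: continuous_in_subspaceT => x; rewrite inE/= in_itv/= => /andP[x0 _].
    by apply: ch; apply: lt_le_trans x0; rewrite divr_gt0.
have Fsub n : [set` F n] `<=` `]0, +oo[.
  move=> x/=; rewrite !in_itv/= andbT => /andP[x0 _].
  by apply: lt_le_trans x0; rewrite divr_gt0.
have Gsub n : [set` G n] `<=` `]0, +oo[.
  by move=> x/=; rewrite !in_itv/= andbT => /andP[x0 _]; lra.
have FU : `]0, m]%classic = \bigcup_n [set` F n].
  apply/seteqP; split => [x/=|x [n _]/=]; rewrite !in_itv/=.
    move=> /andP[x0 xm].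
    (* Such an [n] gives [m ^+ 2 / (m + n) <= x], hence [x] lies in [F n]. *)
    have [n hn] : exists n : nat, m ^+ 2 / x <= n%:R.
      exists (Num.truncn (m ^+ 2 / x)).+1; apply: ltW.
      by apply: truncnS_gt.
    exists n => //=; rewrite in_itv/= xm andbT ler_pdivrMr// mulrC.
    by rewrite -ler_pdivrMr// (le_trans hn)// lerDr ltW.
  move=> /andP[x0 ->]; rewrite andbT.
  by apply: lt_le_trans x0; rewrite divr_gt0.
have GU : `[m, +oo[%classic = \bigcup_n [set` G n].
  exact: itv_bndy_bigcup_BRight.
have mf2 : forall x, 0 < x ->
    {for x, continuous (fun x => h (m ^+ 2 / x) * (m ^+ 2 / x ^+ 2))}.
  move=> x x0; apply: cvgM; last exact: continuous_divr_sqr.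
  apply: (@continuous_comp _ _ _ (fun x => m ^+ 2 / x) h).
    exact: continuous_divr.
  by apply: ch; rewrite divr_gt0.
rewrite FU GU.
have cF : (fun n => \int[mu]_(x in [set` F n]) (h x)%:E)%E @ \oo -->
    (\int[mu]_(x in \bigcup_n [set` F n]) (h x)%:E)%E.
  apply: ge0_nondecreasing_set_cvg_integral => //.
  - move=> i j ij; apply/subsetPset => x/=; rewrite !in_itv/= => /andP[xi ->].
    rewrite andbT (le_trans _ xi)// ler_pM2l// lef_pV2 ?posrE//.
    by rewrite lerD2l ler_nat.
  - by move=> i; apply/measurable_EFinP; exact: continuous_pos_measurable.
  - move=> i x /Fsub/=; rewrite in_itv/= andbT => x0.
    by rewrite lee_fin h0.
have cG : (fun n => \int[mu]_(x in [set` G n])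
      (h (m ^+ 2 / x) * (m ^+ 2 / x ^+ 2))%:E)%E @ \oo -->
    (\int[mu]_(x in \bigcup_n [set` G n])
      (h (m ^+ 2 / x) * (m ^+ 2 / x ^+ 2))%:E)%E.
  apply: ge0_nondecreasing_set_cvg_integral => //.
  - move=> i j ij; apply/subsetPset => x/=; rewrite !in_itv/= => /andP[-> xi]/=.
    by rewrite (le_trans xi)// lerD2l ler_nat.
  - by move=> i; apply/measurable_EFinP; exact: continuous_pos_measurable.
  - move=> i x /Gsub/=; rewrite in_itv/= andbT => x0.
    rewrite lee_fin mulr_ge0// ?h0 ?divr_gt0//.
    by rewrite ltW// divr_gt0// exprn_gt0.
rewrite (funext FG) in cF.
exact: (cvg_unique _ cF cG).
Qed.

Lemma integral_cauchy_schloemilch g b : continuous g -> (forall x, 0 <= g x) ->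
  g =1 g \o -%R -> 0 <= b ->
  (\int[mu]_(x in `]0%R, +oo[) (2 * g (x - b / x))%:E = \int[mu]_x (g x)%:E)%E.
Proof.
move=> cg g0 geven b0.
(* Evenness turns the right side into twice the integral over [[0, +oo[], which matches the factor 2
   on the left. *)
rewrite ge0_symfun_integralT// -set_itvcy.
have cgb x : 0 < x -> {for x, continuous (fun x => g (x - b / x))}.
  move=> x0; apply: (@continuous_comp _ _ _ (fun x => x - b / x) g).
    by apply: cvgB; [exact: cvg_id|exact: continuous_divr].
  exact: cg.
have mgb : measurable_fun `](0 : R), +oo[ (fun x => g (x - b / x)).
  exact: continuous_pos_measurable.
under eq_integral do rewrite EFinM.
rewrite ge0_integralZl//; [|by apply/measurable_EFinP; exact: mgb
  |by move=> x _; rewrite lee_fin; exact: g0].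
congr (2 * _)%E.
(* For [b = 0] there is no [m > 0] to invert about; the integrands coincide and only the endpoint 0
   differs. *)
have [b00|bn0] := eqVneq b 0.
  rewrite -[RHS]integral_itv_obnd_cbnd.
    by apply: eq_integral => x _; rewrite b00 mul0r subr0.
  apply/measurable_EFinP; apply: measurable_funTS.
  exact: continuous_measurable_fun.
have {b0}{}bn0 : 0 < b by rewrite lt_def bn0.
have [m m0 bm] : exists2 m, 0 < m & b = m ^+ 2.
  by exists (Num.sqrt b); rewrite ?sqrtr_gt0// sqr_sqrtr// ltW.
have sub1 : [set` `]0, m]] `<=` `]0, +oo[.
  by move=> x/=; rewrite !in_itv/= andbT => /andP[].
have sub2 : [set` `[m, +oo[] `<=` `]0, +oo[.
  by move=> x/=; rewrite !in_itv/= !andbT; lra.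
have sub2' : [set` `]m, +oo[] `<=` `]0, +oo[.
  by move=> x/=; rewrite !in_itv/= !andbT; lra.
have -> : `]0, +oo[%classic = `]0, m] `|` `]m, +oo[ :> set R.
  by rewrite -itv_bndbnd_setU// bnd_simp ltW.
rewrite ge0_integral_setU//; last 3 first.
- apply/measurable_EFinP.
  rewrite -itv_bndbnd_setU//; exact: ltW.
- by move=> x _; rewrite lee_fin; exact: g0.
- apply/disj_setPLR => x/=; rewrite !in_itv/= andbT => /andP[_].
  by rewrite leNgt => /negP.
rewrite (ge0_integral_inversion _ _ m0)//.
rewrite integral_itv_obnd_cbnd; last first.
  by apply/measurable_EFinP; exact: continuous_pos_measurable.
rewrite -ge0_integralD//; last 4 first.
- move=> x /sub2/=; rewrite in_itv/= andbT => x0.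
  by rewrite lee_fin mulr_ge0// divr_ge0 ?exprn_ge0 ?ltW.
- apply/measurable_EFinP; apply: continuous_pos_measurable => // x x0.
  apply: cvgM; last exact: continuous_divr_sqr.
  apply: (@continuous_comp _ _ _ (fun x => m ^+ 2 / x) (fun x => g (x - b / x))).
    exact: continuous_divr.
  by apply: cgb; rewrite divr_gt0 ?exprn_gt0.
- by move=> x _; rewrite lee_fin; exact: g0.
- by apply/measurable_EFinP; exact: continuous_pos_measurable.
(* The map [x - b / x] vanishes at [m], so it carries [[m, +oo[] onto [[0, +oo[]. The limit of its
   derivative is given as [1 + b * 0], the shape that the limit rules for sums and products
   produce. *)
have {1}-> : 0 = m - b / m by rewrite bm expr2 mulfK ?subrr ?gt_eqF.
rewrite (@ge0_substitutiony_increasing _ (fun x => x - b / x)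
  (fun x => 1 + b / x ^+ 2) _ _ (1 + b * 0))//.
- apply: eq_integral => x; rewrite inE/= in_itv/= andbT => mx.
  have x0 : x != 0 by rewrite gt_eqF// (lt_le_trans m0).
  (* Inversion sends [x - b / x] to its opposite because [b = m ^+ 2]; evenness of [g] absorbs the
     sign. *)
  rewrite -EFinD mulrDr mulr1 addrC bm; congr (_ + _)%:E.
  rewrite mulrC (geven (x - _))/= opprB invf_div mulrCA mulfV ?mulr1//.
    exact: mulrC.
  by rewrite gt_eqF// exprn_gt0.
- move=> x x0; have d1 := is_derive_id x (1 : R).
  have := is_deriveB d1 (is_derive_divr b x x0).
  by rewrite opprK.
- move=> x x0; apply: cvgD; first exact: cvg_cst.
  exact: continuous_divr_sqr.
- by move=> x x0; rewrite ltr_wpDr// divr_ge0 ?exprn_ge0 ?ltW.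
- apply: cvgD; first exact: cvg_cst.
  apply: cvgM; first exact: cvg_cst.
  have x20 : \forall x \near +oo, 0 < (x : R) ^+ 2.
    near=> x; have x0 : 0 < x by near: x; exact: nbhs_pinfty_gt.
    by rewrite exprn_gt0.
  exact: (gtr0_cvgV0 x20).2 cvgr_expr2.
(* Once [x > b], the subtracted term [b / x] is below 1. *)
- apply/cvgryPge => A; near=> x.
  have xb : b < x by near: x; exact: (nbhs_pinfty_gt (num_real _)).
  have xA : A + 1 < x by near: x; exact: (nbhs_pinfty_gt (num_real _)).
  have bx1 : b / x < 1 by rewrite ltr_pdivrMr ?mul1r// (lt_trans bn0).
  by rewrite lerBrDr; lra.
Unshelve. all: by end_near. Qed.
End cauchy_schloemilch.

(** * The one-dimensional factorization *)

(** By uniqueness of Lebesgue measure: [u] times its pushforward under multiplication by [u] gives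
    each half-open interval its length. *)
Lemma ge0_integral_scale (R : realType) (u : R) (f : R -> \bar R) : 0 < u ->
  measurable_fun [set: R] f -> (forall x, 0 <= f x)%E ->
  (\int[lebesgue_measure]_v (u%:E * f (u * v)%R) = \int[lebesgue_measure]_x f x)%E.
Proof.
move=> u0 mf f0.
pose U : measurableTypeR R -> measurableTypeR R := *%R u.
have mU : measurable_fun [set: measurableTypeR R] U by exact: measurable_funM.
pose mixU := isMeasurableFun.Build _ _ _ _ U mU.
pose mfU : {mfun measurableTypeR R >-> measurableTypeR R} := HB.pack U mixU.
have scale A : measurable A -> lebesgue_measure A =
   mscale (NngNum (ltW u0)) (pushforward (@lebesgue_measure R) mfU) A.
  apply: lebesgue_measure_unique => _ [[a b]] _ <- /=.
  have preU : U @^-1` [set` `]a, b]] = [set` `](a / u : R), (b / u : R)]].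
    apply/seteqP; split => x/=; rewrite !in_itv/= /U ltr_pdivrMr// ler_pdivlMr//;
    by rewrite ![u * x]mulrC.
  transitivity (u%:E * lebesgue_measure [set` (`]a / u, b / u]%R : interval R)])%E;
    last by rewrite -preU.
  rewrite !lebesgue_measure_itv/= !lte_fin ltr_pM2r ?invr_gt0//.
  case: ifP => _; last by rewrite mule0.
  by rewrite -EFinB -EFinM -mulrBl mulrCA mulfV ?mulr1// gt_eqF.
rewrite [RHS](eq_measure_integral (mscale (NngNum (ltW u0))
  (pushforward (@lebesgue_measure R) mfU))); last by move=> A mA _; exact: scale.
rewrite ge0_integral_mscale// ge0_integral_pushforward// preimage_setT.
rewrite ge0_integralZl//; last 2 first.
- by apply: measurableT_comp.
- by rewrite lee_fin ltW.
Qed.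

Section factor_kernel.
Context {R : realType}.
Variable g : R -> R.
Hypotheses (cg : continuous g) (g0 : forall x, 0 <= g x).
Hypotheses (geven : g =1 g \o -%R) (g1 : (\int[lebesgue_measure]_x (g x)%:E = 1)%E).
Implicit Types a b x : R.

(* The maximum encodes the restriction to u > 0, and the factor 2 makes up for
   integrating the density [g] over a half-line only. *)
Definition factor_kernel a b : R := 2 * Num.max a 0 * g (a - `|b|).

Let mg : measurable_fun [set: R] g. Proof. exact: continuous_measurable_fun. Qed.

Lemma factor_kernel_ge0 a b : 0 <= factor_kernel a b.
Proof. by rewrite !mulr_ge0// le_max lexx orbT. Qed.

Lemma measurable_factor_kernel d (T : measurableType d) (A B : T -> R) :
  measurable_fun [set: T] A -> measurable_fun [set: T] B ->
  measurable_fun [set: T] (fun t => factor_kernel (A t) (B t)).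
Proof.
move=> mA mB; apply: measurable_funM.
  by apply: measurable_funM => //; exact: measurable_maxr.
apply: measurableT_comp => //; apply: measurable_funB => //.
exact: measurableT_comp.
Qed.

(* [p.1 `^ (-1)] rather than [p.1^-1]: the two agree on the support of the
   indicator, and powR is known to be measurable. *)
Let phi (H : R -> \bar R) (p : R * R) : \bar R :=
  (H p.2 * (\1_(`]0, +oo[) p.1 * (2 * g (p.1 - `|p.2| * p.1 `^ (-1))))%:E)%E.

(** At fixed [a > 0] the substitution [x = a * b] consumes the factor [a] of the kernel. After
    Tonelli, the integral over [a] at fixed [x] is the Cauchy-Schloemilch integral with parameter
    the absolute value of [x], which equals 1. *)
Lemma ge0_integral_factor_kernel (H : R -> \bar R) :
  measurable_fun [set: R] H -> (forall x, 0 <= H x)%E ->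
  (\int[lebesgue_measure]_a \int[lebesgue_measure]_b
     (H (a * b)%R * (factor_kernel a b)%:E) = \int[lebesgue_measure]_x H x)%E.
Proof.
move=> mH H0.
have mphi : measurable_fun [set: measurableTypeR R * measurableTypeR R] (phi H).
  apply: emeasurable_funM; first exact: measurableT_comp.
  apply/measurable_EFinP; apply: measurable_funM.
    by apply: measurableT_comp => //; exact: measurable_indic.
  apply: measurable_funM => //; apply: measurableT_comp => //.
  apply: measurable_funB => //; apply: measurable_funM.
    exact: measurableT_comp.
  exact: (measurableT_comp (measurable_powR _)).
have phi0 p : (0 <= phi H p)%E.
  by rewrite mule_ge0// lee_fin mulr_ge0// mulr_ge0.
transitivity (\int[lebesgue_measure]_a \int[lebesgue_measure]_x phi H (a, x))%E.
  apply: eq_integral => a _; have [a0|a0] := ltP 0 a.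
    rewrite -[RHS](ge0_integral_scale _ _ _ a0)//; last first.
      exact: (measurable_fun_pair2 a mphi).
    apply: eq_integral => b _; rewrite muleCA -EFinM/= indicE mem_set/=; last first.
      by rewrite in_itv/= a0.
    rewrite mul1r /factor_kernel max_l ?(ltW a0)// powR_inv1 ?(ltW a0)//.
    rewrite normrM (gtr0_norm a0) (mulrC a `|b|) mulfK ?gt_eqF//.
    by rewrite mulrCA mulrA.
  (* For [a <= 0] both sides vanish, one through the indicator in [phi], the other through the
     maximum in the kernel. *)
  rewrite !integral0_eq// => b _.
    rewrite /phi/= indicE memNset ?mul0r ?mule0//= in_itv/= andbT.
    by apply/negP; rewrite -leNgt.
  by rewrite /factor_kernel max_r// mulr0 mul0r mule0.
rewrite [LHS](@fubini_tonelli _ _ (measurableTypeR R) (measurableTypeR R) R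
  (@lebesgue_measure R) (@lebesgue_measure R) (phi H))//.
apply: eq_integral => x _.
have mind : measurable_fun [set: R] (fun a => \1_(`]0, +oo[) a *
    (2 * g (a - `|x| * a `^ (-1)))).
  apply: measurable_funM; first exact: measurable_indic.
  apply: measurable_funM => //; apply: measurableT_comp => //.
  apply: measurable_funB => //; apply: measurable_funM => //.
transitivity (H x * \int[lebesgue_measure]_a (\1_(`]0%R, +oo[) a *
    (2 * g (a - `|x| * a `^ (-1))))%:E)%E.
  rewrite -ge0_integralZl//.
  - by apply/measurable_EFinP.
  - by move=> a _; rewrite lee_fin !mulr_ge0.
(* The constant 1 is expanded into the integral of [g], then into the half-line integral that
   appears on the left. *)
rewrite -[RHS]mule1 -g1 -(@integral_cauchy_schloemilch _ g `|x|)//.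
congr (_ * _)%E; rewrite [RHS]integral_mkcond; apply: eq_integral => a _.
rewrite patchE indicE; case: ifPn => [|_]; last by rewrite mul0r.
rewrite inE/= in_itv/= andbT => a0.
by rewrite mul1r powR_inv1// ltW.
Qed.

End factor_kernel.

(** * Induction on the dimension *)

Section lebesgue_rV_integral.
Context {R : realType}.

Lemma ge0_integral_lebesgue_rV0 (f : 'rV[R]_0 -> \bar R) :
  measurable_fun [set: 'rV[R]_0] f ->
  (\int[lebesgue_rV R 0]_x f x = f 0%R)%E.
Proof. by move=> mf; rewrite [LHS]integral_dirac// diracT mul1e. Qed.

(** The measure is by construction the pushforward of a product under [rV_cons], so Tonelli splits
    off the first coordinate. *)
Lemma ge0_integral_lebesgue_rVS n (f : 'rV[R]_n.+1 -> \bar R) :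
  measurable_fun [set: 'rV[R]_n.+1] f -> (forall x, 0 <= f x)%E ->
  (\int[lebesgue_rV R n.+1]_x f x =
   \int[lebesgue_measure]_a \int[lebesgue_rV R n]_x f (@rV_cons R n (a, x)))%E.
Proof.
move=> mf f0.
pose mix := isMeasurableFun.Build _ _ _ _ _ (@measurable_rV_cons R n).
pose cons : {mfun (measurableTypeR R * 'rV[R]_n)%type >-> 'rV[R]_n.+1} :=
  HB.pack (@rV_cons R n) mix.
transitivity
  (\int[pushforward (@lebesgue_measure R \x lebesgue_rV R n)%E cons]_x f x)%E.
  by apply: eq_measure_integral.
rewrite ge0_integral_pushforward// preimage_setT.
rewrite (fubini_tonelli1 (f \o cons))//.
  exact: measurableT_comp.
by move=> x; exact: f0.
Qed.

Lemma measurable_rV_cons2 n d (T : measurableType d) (A : T -> measurableTypeR R)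
  (X : T -> 'rV[R]_n) : measurable_fun [set: T] A -> measurable_fun [set: T] X ->
  measurable_fun [set: T] (fun t => rV_cons (A t, X t)).
Proof.
move=> mA mX; apply: (measurableT_comp (@measurable_rV_cons R n)).
exact: measurable_fun_pair.
Qed.

Lemma measurable_hadamard n d (T : measurableType d) (U V : T -> 'rV[R]_n) :
  measurable_fun [set: T] U -> measurable_fun [set: T] V ->
  measurable_fun [set: T] (fun t => hadamard (U t) (V t)).
Proof.
move=> mU mV; apply: measurable_fun_rVP => i.
rewrite (_ : _ \o _ = fun t => coors i (U t) * coors i (V t)); last first.
  by apply/funext => t; rewrite /coors/= mxE.
by apply: measurable_funM; apply: measurableT_comp => //; exact: measurable_coors.
Qed.

Lemma hadamard_rV_cons n (a b : R) (u v : 'rV[R]_n) :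
  hadamard (rV_cons (a, u)) (rV_cons (b, v)) = rV_cons (a * b, hadamard u v).
Proof. by apply/rowP => i; rewrite !mxE; case: unliftP => //= j _; rewrite mxE. Qed.

End lebesgue_rV_integral.

(** * The product kernel in dimension [n] *)

Section hadamard_kernel.
Context {R : realType}.
Variable g : R -> R.
Hypotheses (cg : continuous g) (g0 : forall x, 0 <= g x).
Hypotheses (geven : g =1 g \o -%R) (g1 : (\int[lebesgue_measure]_x (g x)%:E = 1)%E).

(** A disintegration weight: multiplying a density at [hadamard u v] by it gives a joint density of
    the pair whose product has the original density. *)
Definition hadamard_kernel n (u v : 'rV[R]_n) : R :=
  \prod_i factor_kernel g (u ord0 i) (v ord0 i).

Lemma hadamard_kernel_ge0 n (u v : 'rV[R]_n) : 0 <= hadamard_kernel n u v.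
Proof. by apply: prodr_ge0 => i _; exact: factor_kernel_ge0. Qed.

Lemma measurable_hadamard_kernel n d (T : measurableType d) (U V : T -> 'rV[R]_n) :
  measurable_fun [set: T] U -> measurable_fun [set: T] V ->
  measurable_fun [set: T] (fun t => hadamard_kernel n (U t) (V t)).
Proof.
move=> mU mV; apply: measurable_prod => i _; apply: measurable_factor_kernel => //.
- exact: (measurableT_comp (@measurable_coors R n i)).
- exact: (measurableT_comp (@measurable_coors R n i)).
Qed.

Lemma hadamard_kernel_rV_cons n (a b : R) (u v : 'rV[R]_n) :
  hadamard_kernel n.+1 (rV_cons (a, u)) (rV_cons (b, v)) =
  factor_kernel g a b * hadamard_kernel n u v.
Proof.
rewrite /hadamard_kernel big_ord_recl; congr (_ * _).
  by rewrite !mxE unlift_none.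
by apply: eq_bigr => i _; rewrite !mxE liftK.
Qed.

Lemma measurable_mul_hadamard_kernel n (H : 'rV[R]_n -> \bar R) :
  measurable_fun [set: 'rV[R]_n] H ->
  measurable_fun [set: 'rV[R]_n * 'rV[R]_n]
    (fun p => H (hadamard p.1 p.2) * (hadamard_kernel n p.1 p.2)%:E)%E.
Proof.
move=> mH; apply: emeasurable_funM.
  by apply: measurableT_comp => //; exact: measurable_hadamard.
by apply/measurable_EFinP; exact: measurable_hadamard_kernel.
Qed.

(** Induction with [H] general. With first coordinates [a], [b] split off, Tonelli brings the two
    tails together; the induction hypothesis integrates them, and the one-dimensional identity
    treats [a] and [b]. *)
Lemma ge0_integral_hadamard_kernel n (H : 'rV[R]_n -> \bar R) :
  measurable_fun [set: 'rV[R]_n] H -> (forall x, 0 <= H x)%E ->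
  (\int[lebesgue_rV R n]_u \int[lebesgue_rV R n]_v
     (H (hadamard u v) * (hadamard_kernel n u v)%:E) =
   \int[lebesgue_rV R n]_x H x)%E.
Proof.
elim: n H => [|n IH] H mH H0.
  have mF := measurable_mul_hadamard_kernel 0 H mH.
  rewrite !ge0_integral_lebesgue_rV0//.
  - by rewrite /hadamard_kernel big_ord0 mule1; congr H; apply/rowP => -[].
  - exact: (measurable_fun_pair2 _ mF).
  - apply: (@measurable_fun_fubini_tonelli_F _ _ _ _ R (lebesgue_rV R 0) _ mF).
    by move=> p; rewrite mule_ge0// lee_fin hadamard_kernel_ge0.
pose F (p : 'rV[R]_n.+1 * 'rV[R]_n.+1) :=
  (H (hadamard p.1 p.2) * (hadamard_kernel n.+1 p.1 p.2)%:E)%E.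
have mF := measurable_mul_hadamard_kernel n.+1 H mH.
rewrite -/F in mF.
have F0 p : (0 <= F p)%E by rewrite mule_ge0// lee_fin hadamard_kernel_ge0.
rewrite ge0_integral_lebesgue_rVS; last 2 first.
- exact: (@measurable_fun_fubini_tonelli_F _ _ _ _ R (lebesgue_rV R n.+1) F mF F0).
- by move=> u; apply: integral_ge0 => v _; exact: (F0 (u, v)).
(* [H1] is the marginal of [H] in the first coordinate, the function to which the one-dimensional
   identity is applied, from right to left. *)
pose H1 (y : R) := (\int[lebesgue_rV R n]_x H (@rV_cons R n (y, x)))%E.
have mH1 : measurable_fun [set: R] H1.
  apply: (@measurable_fun_fubini_tonelli_F _ _ (measurableTypeR R) 'rV[R]_n R
    (lebesgue_rV R n) (H \o @rV_cons R n)).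
    by apply: measurableT_comp => //; exact: measurable_rV_cons.
  by move=> x; exact: H0.
have H10 y : (0 <= H1 y)%E by apply: integral_ge0 => x _; exact: H0.
rewrite [RHS]ge0_integral_lebesgue_rVS//.
rewrite -(@ge0_integral_factor_kernel _ g cg g0 geven g1 H1 mH1 H10).
apply: eq_integral => a _.
transitivity (\int[lebesgue_rV R n]_u
  \int[lebesgue_measure]_b \int[lebesgue_rV R n]_v
  F (@rV_cons R n (a, u), @rV_cons R n (b, v)))%E.
  apply: eq_integral => u _.
  rewrite -(ge0_integral_lebesgue_rVS _ (fun v => F (@rV_cons R n (a, u), v)))//.
  exact: (measurable_fun_pair2 _ mF).
pose F3 (q : ('rV[R]_n * R) * 'rV[R]_n) :=
  F (@rV_cons R n (a, q.1.1), @rV_cons R n (q.1.2, q.2)).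
have mF3 : measurable_fun [set: ('rV[R]_n * measurableTypeR R) * 'rV[R]_n] F3.
  apply: measurableT_comp => //; apply: measurable_fun_pair.
    apply: measurable_rV_cons2 => //.
    exact: measurableT_comp.
  apply: measurable_rV_cons2 => //.
  exact: measurableT_comp.
(* This exchanges the tail [u] with the scalar [b], so that the integrals over [u] and [v] become
   adjacent. *)
rewrite [LHS](@fubini_tonelli _ _ 'rV[R]_n (measurableTypeR R) R
  (lebesgue_rV R n) (@lebesgue_measure R)
  (fun p => \int[lebesgue_rV R n]_v F3 (p, v)))%E; last 2 first.
- apply: (@measurable_fun_fubini_tonelli_F _ _ _ _ _ (lebesgue_rV R n) _ mF3).
  by move=> q; exact: F0.
- by move=> p; apply: integral_ge0 => v _; exact: F0.
apply: eq_integral => b _.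
(* With [a] and [b] frozen, the induction hypothesis is used on this slice of [H]; the scalar kernel
   is a constant factor. *)
pose H' x := (H (@rV_cons R n ((a * b)%R, x)) * (factor_kernel g a b)%:E)%E.
have mHc : measurable_fun [set: 'rV[R]_n] (fun x => H (@rV_cons R n (a * b, x))).
  by apply: measurableT_comp => //; exact: measurable_rV_cons2.
have k0 := factor_kernel_ge0 g g0 a b.
transitivity (\int[lebesgue_rV R n]_x H' x)%E; last first.
  by rewrite ge0_integralZr// => x _; exact: H0.
rewrite -IH.
- apply: eq_integral => u _; apply: eq_integral => v _.
  by rewrite /F3 /F/= hadamard_rV_cons hadamard_kernel_rV_cons /H' EFinM muleA.
- exact: emeasurable_funM.
- by move=> x; rewrite mule_ge0.
Qed.

End hadamard_kernel.

(** * The densities *)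

Section hadamard_law.
Context {R : realType} (n : nat).
Variable g : R -> R.
Hypotheses (cg : continuous g) (g0 : forall x, 0 <= g x).
Hypotheses (geven : g =1 g \o -%R) (g1 : (\int[lebesgue_measure]_x (g x)%:E = 1)%E).

(** This lets an integral over [calX] be extended to the whole product space, where Tonelli
    applies. *)
Lemma hadamard_kernel_notin_calX (p : 'rV[R]_n * 'rV[R]_n) :
  ~ calX R n p -> hadamard_kernel g n p.1 p.2 = 0.
Proof.
move=> /existsNP[i /negP]; rewrite -leNgt => ui.
by rewrite /hadamard_kernel (bigD1 i)//= /factor_kernel max_r// mulr0 !mul0r.
Qed.

(** The positive and negative parts are transported separately. Since the integral is the difference
    of the two in the extended reals, the identity covers signed [H] without integrability. *)
Lemma integral_hadamard_kernel (H : 'rV[R]_n -> \bar R) :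
  measurable_fun [set: 'rV[R]_n] H ->
  (\int[lebesgue_rV2 R n]_(p in calX R n)
     (H (hadamard p.1 p.2) * (hadamard_kernel g n p.1 p.2)%:E) =
   \int[lebesgue_rV R n]_x H x)%E.
Proof.
move=> mH; set F := (X in (\int[_]_(p in _) X p)%E).
have k0 (p : 'rV[R]_n * 'rV[R]_n) := hadamard_kernel_ge0 g g0 n p.1 p.2.
have -> : (\int[lebesgue_rV2 R n]_(p in calX R n) F p =
    \int[lebesgue_rV2 R n]_p F p)%E.
  rewrite integral_mkcond; congr (integral _ _ _); apply/funext => p.
  rewrite patchE; case: ifPn => // /negP; rewrite inE => pX.
  by rewrite /F hadamard_kernel_notin_calX// mule0.
have ge0E (h : 'rV[R]_n -> \bar R) : measurable_fun [set: 'rV[R]_n] h ->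
    (forall x, 0 <= h x)%E ->
  (\int[lebesgue_rV2 R n]_p
     (h (hadamard p.1 p.2) * (hadamard_kernel g n p.1 p.2)%:E) =
   \int[lebesgue_rV R n]_x h x)%E.
  move=> mh h0; rewrite -(@ge0_integral_hadamard_kernel _ g)//.
  rewrite /lebesgue_rV2 fubini_tonelli1//.
    exact: measurable_mul_hadamard_kernel.
  by move=> p; rewrite mule_ge0// lee_fin.
rewrite integralE [RHS]integralE -!ge0E//; last 2 first.
- exact: measurable_funeneg.
- exact: measurable_funepos.
(* The kernel is nonnegative, so multiplying by it commutes with taking positive and negative
   parts. *)
congr (_ - _)%E; apply: eq_integral => p _.
- by rewrite !funeposE maxe_pMl ?mul0e ?lee_fin.
- by rewrite !funenegE -mulNe maxe_pMl ?mul0e ?lee_fin.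
Qed.

End hadamard_law.

(** * The Gaussian kernel, the normalization constants and the laws *)

Section laplace_density.
Context {R : realType} (d : nat) (beta lambda : R) (G : 'rV[R]_d -> R).
Hypotheses (hbeta : 0 < beta) (hlambda : 0 < lambda).
Hypothesis mG : measurable_fun [set: 'rV[R]_d] G.

(** The standard deviation for which the normal density is proportional to
    [expR (- (beta * lambda / 2) * x ^+ 2)]. *)
Let s : R := Num.sqrt (beta * lambda)^-1.
(** The integral of that unnormalized Gaussian over a half-line, so that [2 * c] is its total
    mass. *)
Let c : R := Num.sqrt (pi / (2 * beta * lambda)).
Let g : R -> R := normal_pdf 0 s.

Let bl0 : 0 < beta * lambda. Proof. exact: mulr_gt0. Qed.

Let s0 : s != 0.
Proof. by rewrite gt_eqF// sqrtr_gt0 invr_gt0. Qed.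

Let c0 : 0 < c.
Proof. by rewrite sqrtr_gt0 divr_gt0 ?pi_gt0// -mulrA mulr_gt0. Qed.

Let gE x : g x = (2 * c)^-1 * expR (- (beta * lambda / 2) * x ^+ 2).
Proof.
rewrite /g normal_pdfE// /normal_peak /normal_fun subr0.
have s2 : s ^+ 2 = (beta * lambda)^-1 by rewrite sqr_sqrtr// invr_ge0 ltW.
have bl : beta * lambda != 0 by rewrite gt_eqF.
congr (_^-1 * expR _).
  have -> : (2 : R) = Num.sqrt (2 ^+ 2) by rewrite sqrtr_sqr ger0_norm.
  rewrite -sqrtrM ?sqr_ge0// s2; congr Num.sqrt.
  rewrite -mulr_natl. field.
  by rewrite !gt_eqF.
rewrite s2 -mulr_natl; field.
by rewrite !gt_eqF.
Qed.

Let cg : continuous g. Proof. exact: continuous_normal_pdf. Qed.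

Let g0 x : 0 <= g x. Proof. exact: normal_pdf_ge0. Qed.

Let geven : g =1 g \o -%R.
Proof. by move=> x; rewrite /= !gE sqrrN. Qed.

Let g1 : (\int[lebesgue_measure]_x (g x)%:E = 1)%E.
Proof. exact: integral_normal_pdf. Qed.

(** Each kernel factor carries [2 * (2 * c)^-1 = c^-1], which the power of [c] compensates; the
    exponents match by completing the square. *)
Lemma pi_weightE p : calX R d p ->
  pi_weight beta lambda G p =
  c ^+ d * rho_weight beta lambda G (hadamard p.1 p.2) * hadamard_kernel g d p.1 p.2.
Proof.
move=> pX; set u := p.1; set v := p.2.
have kE i : factor_kernel g (u ord0 i) (v ord0 i) =
    c^-1 * (u ord0 i *
    expR (- (beta * lambda / 2) * (u ord0 i - `|v ord0 i|) ^+ 2)).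
  rewrite /factor_kernel gE max_l ?(ltW (pX i))//.
  by field; rewrite gt_eqF.
rewrite /hadamard_kernel; under eq_bigr do rewrite kE.
rewrite !big_split/= -expR_sum prodr_const card_ord exprVn.
rewrite /pi_weight -/u -/v /rho_weight.
have cd0 : c ^+ d != 0 by rewrite expf_neq0// gt_eqF.
rewrite -[RHS]mulrA (mulrCA (expR _)) mulVKf// [RHS]mulrCA; congr (_ * _).
rewrite -expRD; congr expR.
set S := \sum_i _.
(* Coordinatewise this is the square of [u - |v|] plus [2 * u * |v|]; positivity of [u] identifies
   [u * |v|] with [|u * v|]. *)
have key : - beta * (2^-1 * lambda * (l2norm u ^+ 2 + l2norm v ^+ 2)) =
    - beta * (lambda * l1norm (hadamard u v)) + S.
  rewrite /l2norm !sqr_sqrtr; last 2 first.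
  - by apply: sumr_ge0 => *; rewrite sqr_ge0.
  - by apply: sumr_ge0 => *; rewrite sqr_ge0.
  rewrite /l1norm /S -big_split/= !mulr_sumr -big_split/=; apply: eq_bigr => i _.
  rewrite mxE normrM (gtr0_norm (pX i)) -(real_normK (num_real (v ord0 i))).
  by field.
by rewrite (mulrDr (- beta)) key [in RHS](mulrDr (- beta)) addrAC.
Qed.

Lemma measurable_rho_weight :
  measurable_fun [set: 'rV[R]_d] (rho_weight beta lambda G).
Proof.
apply: measurableT_comp => //; apply: measurable_funM => //.
apply: measurable_funD => //; apply: measurable_funM => //.
apply: measurable_sum => i; apply: measurableT_comp => //.
exact: measurable_coors.
Qed.

(** The kernel identity applied to [c ^+ d] times the weight of [rho]. *)
Lemma pi_ZE : pi_Z beta lambda G = ((c ^+ d)%:E * rho_Z beta lambda G)%E.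
Proof.
have mrho := measurable_rho_weight.
rewrite /pi_Z /rho_Z -ge0_integralZl//; last 3 first.
- exact/measurable_EFinP.
- by move=> x _; rewrite lee_fin expR_ge0.
- by rewrite lee_fin exprn_ge0// ltW.
rewrite -(@integral_hadamard_kernel _ _ g)//.
  by apply: eq_integral => p /set_mem pX; rewrite pi_weightE// -!EFinM.
apply/measurable_EFinP; exact: measurable_funM.
Qed.

Hypothesis hZ : (rho_Z beta lambda G < +oo)%E.

Lemma inv_rho_ZE :
  (fine (rho_Z beta lambda G))^-1 = (fine (pi_Z beta lambda G))^-1 * c ^+ d.
Proof.
have rfin : rho_Z beta lambda G \is a fin_num.
  rewrite ge0_fin_numE//; apply: integral_ge0 => x _.
  by rewrite lee_fin expR_ge0.
rewrite pi_ZE fineM//= invfM mulrAC mulVf ?mul1r//.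
by rewrite expf_neq0// gt_eqF.
Qed.

(** The ratio of the normalization constants is exactly the power of [c] in [pi_weightE]. *)
Lemma pi_densityE p : calX R d p ->
  pi_density beta lambda G p =
  rho beta lambda G (hadamard p.1 p.2) * hadamard_kernel g d p.1 p.2.
Proof.
by move=> pX; rewrite /pi_density /rho pi_weightE// inv_rho_ZE !mulrA.
Qed.

(** Common source of both integral claims: [h] is an indicator for the law, and a smooth function
    for the expectation formula. *)
Lemma integral_pi_density (h : 'rV[R]_d -> R) :
  measurable_fun [set: 'rV[R]_d] (fun x => (h x * rho beta lambda G x)%:E) ->
  (\int[lebesgue_rV2 R d]_(p in calX R d)
     (h (hadamard p.1 p.2) * pi_density beta lambda G p)%:E =
   \int[lebesgue_rV R d]_x (h x * rho beta lambda G x)%:E)%E.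
Proof.
move=> mh; rewrite -(@integral_hadamard_kernel _ _ g)//.
by apply: eq_integral => p /set_mem pX; rewrite pi_densityE// mulrA -EFinM.
Qed.

Lemma has_density_hadamard (dW : measure_display) (W : measurableType dW)
    (P : probability W R) (U V : W -> 'rV[R]_d) :
  has_density P (fun w => (U w, V w)) (lebesgue_rV2 R d) (calX R d)
    (pi_density beta lambda G) ->
  has_density P (fun w => hadamard (U w) (V w)) (lebesgue_rV R d) setT
    (rho beta lambda G).
Proof.
move=> [/measurable_fun_pairP[mU mV] UV]; split; first exact: measurable_hadamard.
move=> A mA; set m := fun p : 'rV[R]_d * 'rV[R]_d => hadamard p.1 p.2.
have mmA : measurable (m @^-1` A).
  by rewrite -[X in measurable X]setTI; apply: measurable_hadamard.
(* The product lies in [A] exactly when the pair lies in the preimage of [A], so the hypothesis on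
   the pair applies. *)
transitivity (pushforward P (fun w => (U w, V w)) (m @^-1` A)); first by [].
have indicE' (f : 'rV[R]_d -> R) x :
    ((EFin \o f) \_ A) x = (\1_A x * f x)%:E.
  by rewrite patchE indicE; case: ifPn => _; rewrite ?mul1r ?mul0r.
rewrite UV// setTI integral_mkcondr.
rewrite [RHS]integral_mkcond.
under [RHS]eq_integral do rewrite (indicE' (rho beta lambda G)).
rewrite -integral_pi_density.
  apply: eq_integral => p _; rewrite patchE indicE.
  rewrite (_ : (p \in m @^-1` A) = (m p \in A)); last first.
    by apply/idP/idP => /set_mem pA; exact/mem_set.
  by case: ifPn => _; rewrite ?mul1r ?mul0r.
apply/measurable_EFinP; apply: measurable_funM; first exact: measurable_indic.
apply: measurable_funM => //; exact: measurable_rho_weight.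
Qed.

End laplace_density.

Theorem theorem1p1 (R : realType) (d : nat) (beta lambda : R)
    (G : 'rV[R]_d -> R)
    (hd : (1 <= d)%N) (hbeta : 0 < beta) (hlambda : 0 < lambda)
    (mG : measurable_fun [set: 'rV[R]_d] G)
    (hZ : (rho_Z beta lambda G < +oo)%E) :
  [/\ (forall (dW : measure_display) (W : measurableType dW)
          (P : probability W R) (U V : W -> 'rV[R]_d),
        has_density P (fun w => (U w, V w)) (lebesgue_rV2 R d) (calX R d)
          (pi_density beta lambda G) ->
        has_density P (fun w => hadamard (U w) (V w)) (lebesgue_rV R d) setT
          (rho beta lambda G)),
      (forall phi : 'rV[R]_d -> R, smooth phi ->
        integral_defined (lebesgue_rV2 R d) (calX R d)
          (fun p => (phi (hadamard p.1 p.2) * pi_density beta lambda G p)%:E) ->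
        integral_defined (lebesgue_rV R d) setT
          (fun x => (phi x * rho beta lambda G x)%:E) ->
        (\int[lebesgue_rV2 R d]_(p in calX R d)
            (phi (hadamard p.1 p.2) * pi_density beta lambda G p)%:E
         = \int[lebesgue_rV R d]_x (phi x * rho beta lambda G x)%:E)%E)
    & (fine (rho_Z beta lambda G))^-1
      = (fine (pi_Z beta lambda G))^-1
        * Num.sqrt (pi / (2 * beta * lambda)) ^+ d].
Proof.
split.
- by move=> dW W P U V; exact: has_density_hadamard.
(* Measurability of [phi * rho] comes from its integral being defined. *)
- by move=> phi _ _ [mphi _]; exact: integral_pi_density.
- exact: inv_rho_ZE.
Qed.
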